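(* Let $w$ be a weight on $T$ for which there is $\eta\in(0,1)$ such that for every $R\in\mathcal R$ and $S\subset R$ $$\mu(S)\le(1-C_D)\mu(R)\ \Longrightarrow\ w_\mu(S)\le\eta\,w_\mu(R).$$ Then there is a constant $D'_{CZ}$ such that for every function $f$ on $T$, every $\lambda>0$ and every $R\in\mathcal R$ with $\frac1{w_\mu(R)}\sum_{y\in R}|f(y)|w(y)\mu(y)<\lambda$, there exists a (possibly empty) family $\mathcal F$ of disjoint sets belonging to $\mathcal R$ such that for each $E\in\mathcal F$ the following hold: (i) $\frac1{w_\mu(E)}\sum_{y\in E}|f(y)|w(y)\mu(y)\ge\lambda$; (ii) $\frac1{w_\mu(E)}\sum_{y\in E}|f(y)|w(y)\mu(y)<D'_{CZ}\lambda$; and, moreover, (iii) if $x\in R\setminus\bigcup_{E\in\mathcal F}E$, then $|f(x)|<\lambda$.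
   Context: Tree and flow measure. $T$ is (the vertex set of) an infinite tree, i.e. an infinite connected graph with no loops. $d$ is the geodesic distance and $x\sim y$ means $d(x,y)=1$. $\partial T$ is the boundary of $T$ (equivalence classes of semi-infinite geodesics, two being equivalent if they eventually coincide). Fix $\omega_*\in\partial T$; $[x,\omega_* )$ is the semi-infinite geodesic from $x$ to $\omega_*$, and $x\le y$ means $y\in[x,\omega_* )$. Fix $o\in T$, enumerate $[o,\omega_* )=\{x_j\}_{j\in\mathbb N}$ with $x_0=o$ and $d(x_j,x_k)=|j-k|$, and define the level $\ell(x)=\lim_{j\to\infty}(j-d(x,x_j))$. The set of successors of $x$ is $s(x)=\{y\sim x:\ell(y)=\ell(x)-1\}$. A flow measure is a positive function $\mu$ on $T$ with $\mu(x)=\sum_{y\in s(x)}\mu(y)$ for all $x\in T$; $\mu(E)=\sum_{y\in E}\mu(y)$. Standing assumption: $\mu$ is a flow measure which is locally doubling on $(T,d)$, i.e. for every $r>0$ there is $D_r$ with $\mu(B(x,2r))\le D_r\,\mu(B(x,r))$ for all $x\in T$ (this implies that $T$ has uniformly bounded degree). A weight is a positive function on $T$; for $E\subset T$, $w_\mu(E)=\sum_{y\in E}w(y)\mu(y)$. Trapezoids. Fix a number $\beta\ge 12$. For $x\in T$ and $h_1,h_2\in\mathbb N$, $h_1<h_2$, the trapezoid with root $x$ and heights $h_1,h_2$ is $R_{h_1}^{h_2}(x)=\{y\in T: y\le x,\ h_1\le d(x,y)<h_2\}$. It is admissible if $2\le h_2/h_1\le\beta$ (so $h_1\ge1$). $\mathcal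 R$ is the family of all admissible trapezoids and all singletons. The constant $C_D$. Since $\mu$ is locally doubling, there exist (known fact) a constant $C_D\in(0,1)$ and an integer $N$, fixed once and for all, such that every $R\in\mathcal R$ with more than one element is a disjoint union $R=\bigcup_{i=1}^M R_i$ with $2\le M\le N$, $R_i\in\mathcal R$ and $\mu(R_i)\ge C_D\,\mu(R)$ for all $i=1,\dots,M$. *)

(* Defs.v *)
From HB Require Import structures.
From mathcomp Require Import all_boot all_order all_algebra.
From mathcomp Require Import all_classical all_reals all_analysis.
Import Order.TTheory GRing.Theory Num.Theory.
Import numFieldNormedType.Exports.

Set Implicit Arguments.
Unset Strict Implicit.
Unset Printing Implicit Defensive.

Local Open Scope classical_set_scope.
Local Open Scope ring_scope.
Local Open Scope ereal_scope.

(* In [tree_acyclic], cycles of size 2 are the trivial back-and-forth walks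
   x, y, x along one edge; they have to be allowed. *)
Record tree := Tree {
  vertex :> choiceType;
  adj : rel vertex;
  adj_sym : symmetric adj;
  adj_irr : irreflexive adj;
  tree_connected : forall x y : vertex, exists p, path adj x p /\ last x p = y;
  tree_acyclic : forall c : seq vertex, ucycle adj c -> (size c <= 2)%N;
  tree_infinite : infinite_set [set: vertex]
}.

Section Distance.
Variable T : tree.
Implicit Types x y : T.

Definition walk_length x y (n : nat) : bool :=
  `[< exists p, [/\ path (@adj T) x p, last x p = y & size p = n] >].

Lemma walk_length_ex x y : exists n, walk_length x y n.
Proof.
have [p [xp py]] := tree_connected x y.
by exists (size p); apply/asboolP; exists p.
Qed.

Definition dist x y : nat := ex_minn (walk_length_ex x y).

Definition geodesic_ray (g : nat -> T) : Prop :=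
  forall i j, (i <= j)%N -> dist (g i) (g j) = (j - i)%N.

(* Eventual coincidence is up to a shift of the parametrization. *)
Definition ray_equiv (g h : nat -> T) : Prop :=
  exists i j : nat, forall n : nat, g (i + n)%N = h (j + n)%N.

End Distance.

Record boundary (T : tree) := Boundary {
  rays :> set (nat -> T);
  raysP : exists2 g, geodesic_ray g &
    rays = [set h | geodesic_ray h /\ ray_equiv g h]
}.

Section Order.
Variables (T : tree) (omega : boundary T).

(* The (unique) ray in the class omega starting at x. *)
Definition ray_from (x : T) : nat -> T :=
  xget (fun=> x) [set g | rays omega g /\ g 0%N = x].

Definition below (x y : T) : Prop := range (ray_from x) y.

End Order.

Section Flow.
Variables (R : realType) (T : tree) (omega : boundary T) (o : T).

(* The sequence under the limit is integer-valued and eventually constant. *)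
Definition level (x : T) : R :=
  lim ((fun j : nat => (j%:R - (dist x (ray_from omega o j))%:R)%R : R) @ \oo).

Definition successors (x : T) : set T :=
  [set y | adj x y /\ level y = (level x - 1)%R].

Definition mass (nu : T -> R) (E : set T) : \bar R :=
  \esum_(y in E) (nu y)%:E.

Definition positive_fun (nu : T -> R) : Prop := forall x, (0 < nu x)%R.

Definition flow_measure (mu : T -> R) : Prop :=
  positive_fun mu /\ forall x, (mu x)%:E = mass mu (successors x).

Definition ball_tree (x : T) (r : R) : set T :=
  [set y | ((dist x y)%:R <= r)%R].

Definition locally_doubling (mu : T -> R) : Prop :=
  forall r : R, (0 < r)%R -> exists D : R, forall x : T,
    mass mu (ball_tree x (2 * r)%R) <= D%:E * mass mu (ball_tree x r).

End Flow.

Section Trapezoids.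
Variables (R : realType) (T : tree) (omega : boundary T).

Definition trapezoid (h1 h2 : nat) (x : T) : set T :=
  [set y | below omega y x /\ (h1 <= dist x y < h2)%N].

Definition admissible (beta : R) (h1 h2 : nat) : Prop :=
  [/\ (0 < h1 < h2)%N, (2 <= h2%:R / h1%:R :> R)%R & (h2%:R / h1%:R <= beta)%R].

Definition trapezoid_family (beta : R) : set (set T) :=
  [set E | (exists x, E = [set x]) \/
           (exists x h1 h2, admissible beta h1 h2 /\ E = trapezoid h1 h2 x)].

Definition decomposition_property (beta : R) (mu : T -> R) (CD : R) (N : nat) :=
  forall E : set T, trapezoid_family beta E ->
    (exists x y, [/\ E x, E y & x != y]) ->
    exists (M : nat) (P : nat -> set T),
      [/\ (2 <= M <= N)%N,
          trivIset `I_M P,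
          E = \bigcup_(i in `I_M) P i,
          forall i, (i < M)%N -> trapezoid_family beta (P i) &
          forall i, (i < M)%N -> CD%:E * mass mu E <= mass mu (P i)].

End Trapezoids.

Section Weights.
Variables (R : realType) (T : tree).

Definition wmass (w mu : T -> R) (E : set T) : \bar R :=
  mass (fun y => w y * mu y)%R E.

(* Average of |f| over E with respect to the measure w mu. *)
Definition waverage (w mu f : T -> R) (E : set T) : \bar R :=
  (wmass w mu E)^-1 * \esum_(y in E) (`|f y| * w y * mu y)%:E.

End Weights.

(* Main.v *)
Require Import Defs.
From mathcomp Require Import all_boot all_order all_algebra.
From mathcomp Require Import finmap zify lra.
From mathcomp Require Import all_classical all_reals all_analysis.
Import Order.TTheory GRing.Theory Num.Theory.
Import numFieldNormedType.Exports.

(** This is a stopping-time argument. Split the set E, whose average is below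
lambda, into the pieces given by the decomposition property. A piece whose
average is at least lambda is selected; a piece whose average is still below
lambda is split again. When a set is reduced to one point x, its average is
|f x|, so an unselected point satisfies |f x| < lambda.

The average of a selected piece P is controlled by that of the set E it was cut
from, provided P carries a fixed share of the weight of E. Since
mu P >= CD mu E, the complement of P in E has mu-mass at most (1 - CD) mu E,
hence weight at most eta times that of E, and P keeps the share 1 - eta
([wmass_heavy_child]). The average over P is thus smaller than
lambda / (1 - eta), and the constant of the theorem is 1 / (1 - eta).

The procedure stops because admissible trapezoids are finite sets
([trapezoid_family_finite]), and because a piece of a set with two elements is
a proper subset of it: there are at least two pieces, and none is empty, having
positive mass. Finiteness comes from the doubling condition, which compares the
mass of a ball of radius 1 with the mass of its centre. A vertex x then has
neighbours of total mass at most D mu x, each of mass at least mu x / D, so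
there are finitely many of them ([neighbours_finite]). *)

Set Implicit Arguments.
Unset Strict Implicit.
Unset Printing Implicit Defensive.

Local Open Scope classical_set_scope.
Local Open Scope ring_scope.
Local Open Scope ereal_scope.

(** * Masses of sets of vertices *)

Lemma mass_fin_num (R : realType) (T : tree) (nu : T -> R) (E : set T) :
  (forall x, 0 <= nu x)%R -> finite_set E -> mass nu E \is a fin_num.
Proof.
move=> nu0 fE; rewrite /mass esum_fset// => [|x _]; last by rewrite lee_fin.
by rewrite fsumEFin.
Qed.

Lemma mass_split (R : realType) (T : tree) (nu : T -> R) (E A : set T) :
  (forall x, 0 <= nu x)%R -> A `<=` E ->
  mass nu E = mass nu A + mass nu (E `\` A).
Proof.
move=> nu0 AE; rewrite /mass (esumID A) => [|x _]; last by rewrite lee_fin.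
by rewrite setIidr.
Qed.

Lemma mass_ge0 (R : realType) (T : tree) (nu : T -> R) (E : set T) :
  (forall x, 0 <= nu x)%R -> 0 <= mass nu E.
Proof. by move=> nu0; apply: esum_ge0 => x _; rewrite lee_fin. Qed.

Lemma le_mass (R : realType) (T : tree) (nu : T -> R) (A E : set T) :
  (forall x, 0 <= nu x)%R -> A `<=` E -> mass nu A <= mass nu E.
Proof.
by move=> nu0 AE; rewrite [leRHS](mass_split nu0 AE) leeDl// mass_ge0.
Qed.

Lemma mass_set1 (R : realType) (T : tree) (nu : T -> R) (x : T) :
  (forall x, 0 <= nu x)%R -> mass nu [set x] = (nu x)%:E.
Proof. by move=> nu0; rewrite /mass esum_set1// lee_fin. Qed.

Lemma mass_gt0 (R : realType) (T : tree) (nu : T -> R) (E : set T) :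
  positive_fun nu -> E !=set0 -> 0 < mass nu E.
Proof.
move=> nu_gt0 [x Ex]; have nu0 y : (0 <= nu y)%R by exact: ltW.
apply: (@lt_le_trans _ _ (mass nu [set x])); last first.
  by apply: le_mass => // y ->.
by rewrite mass_set1// lte_fin.
Qed.

(** A set of large cardinality whose points all have mass at least c has mass
larger than any given M. *)
Lemma finite_set_mass (R : realType) (T : tree) (nu : T -> R) (E : set T)
    (c M : R) :
  (0 < c)%R -> (forall x, 0 <= nu x)%R -> (forall x, E x -> c <= nu x)%R ->
  mass nu E <= M%:E -> finite_set E.
Proof.
move=> c0 nu0 cnu ME; apply: contrapT => infE.
have [B BE cardB] := infinite_set_fset (Num.truncn (M / c)).+1 infE.
suff : M%:E < mass nu E by rewrite ltNge ME.
apply: (@lt_le_trans _ _ (mass nu [set` B])); last exact: le_mass.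
rewrite /mass esum_fset// => [|x _]; last by rewrite lee_fin.
rewrite fsumEFin// lte_fin fsbig_finite//= set_fsetK.
apply: (@lt_le_trans _ _ (#|` B|%:R * c)%R).
  rewrite -ltr_pdivrMr//; apply: lt_le_trans (truncnS_gt _) _.
  by rewrite ler_nat.
have -> : (#|` B|%:R * c = \sum_(x <- B) c)%R.
  by rewrite big_const_seq count_predT iter_addr_0 mulr_natl.
rewrite big_seq [leRHS]big_seq; apply: ler_sum => x xB.
exact/cnu/BE.
Qed.

(** * Finiteness of trapezoids *)

Lemma dist0 (T : tree) (x y : T) : dist x y = 0%N -> y = x.
Proof.
rewrite /dist; case: ex_minnP => n /asboolP[p [_ <- <-]] _ /size0nil ->.
by [].
Qed.

Lemma dist_le_walk (T : tree) (x : T) (p : seq T) :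
  path (@adj T) x p -> (dist x (last x p) <= size p)%N.
Proof.
move=> xp; rewrite /dist; case: ex_minnP => n _; apply.
by apply/asboolP; exists p.
Qed.

(** The balls of radius 1/2 are single points, so doubling them bounds the mass
of the star of x by that of x. The same bound at a neighbour z, whose star
contains x, bounds the mass of z from below. *)
Lemma neighbours_finite (R : realType) (T : tree) (mu : T -> R) :
  positive_fun mu -> locally_doubling mu ->
  forall x : T, finite_set [set y | adj x y].
Proof.
move=> mu_gt0 mu_dbl; have mu0 x : (0 <= mu x)%R by exact: ltW.
have half_gt0 : (0 < 2^-1 :> R)%R by rewrite invr_gt0.
have [D mu_ball] := mu_dbl _ half_gt0.
have {mu_ball}star_le x (A : set T) :
    A `<=` [set y | adj x y] -> mass mu A <= (D * mu x)%:E.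
  move=> Ax; rewrite EFinM -(mass_set1 x mu0).
  have -> : [set x] = ball_tree x (2^-1 : R).
    apply/seteqP; split => y; rewrite /ball_tree /=.
      move=> ->; have := @dist_le_walk _ x [::] isT.
      by rewrite leqn0 => /eqP ->; rewrite invr_ge0.
    case: (posnP (dist x y)) => [/dist0 //|dxy le_half].
    have : (1 <= (dist x y)%:R :> R)%R by rewrite ler1n.
    by move=> ge1; exfalso; lra.
  apply: le_trans (mu_ball x); apply: le_mass => // y /Ax /= xy.
  rewrite /ball_tree/= divff// lern1.
  by apply: (@dist_le_walk _ x [:: y]); rewrite /= xy.
move=> x; apply: contrapT => infx; apply: (infx).
have [y xy] : [set y | adj x y] !=set0 by apply/infinite_setN0.
have nb_ge z : adj x z -> (mu x <= D * mu z)%R.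
  move=> xz; rewrite -lee_fin -(mass_set1 x mu0).
  by apply: star_le => _ ->; rewrite /= adj_sym.
have D0 : (0 < D)%R.
  by rewrite -(pmulr_lgt0 _ (mu_gt0 y)); apply: lt_le_trans (nb_ge y xy).
apply: (@finite_set_mass _ _ mu _ (mu x / D) (D * mu x)) => //.
- by rewrite divr_gt0.
- by move=> z xz; rewrite ler_pdivrMr// mulrC; exact: nb_ge.
- exact: star_le.
Qed.

Lemma sphere_finite (T : tree) (n : nat) (x : T) :
  (forall x : T, finite_set [set y | adj x y]) ->
  finite_set [set y | walk_length x y n].
Proof.
move=> nbfin; elim: n x => [|n IHn] x.
  apply: (@sub_finite_set _ _ [set x]) => [y /asboolP[p [_ <- /size0nil ->]]//|].
  exact: finite_set1.
apply: (@sub_finite_set _ _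
  (\bigcup_(z in [set z | adj x z]) [set y | walk_length z y n])).
  move=> y /asboolP[[|z p] []//= /andP[xz zp] zpy [pn]].
  by exists z => //=; apply/asboolP; exists p.
by apply: bigcup_finite => // z _; exact: IHn.
Qed.

Lemma trapezoid_family_finite (R : realType) (T : tree) (omega : boundary T)
    (beta : R) (E : set T) :
  (forall x : T, finite_set [set y | adj x y]) ->
  trapezoid_family omega beta E -> finite_set E.
Proof.
move=> nbfin [[x ->]|[x [h1 [h2 [_ ->]]]]]; first exact: finite_set1.
apply: (@sub_finite_set _ _ (\bigcup_(n in `I_h2) [set y | walk_length x y n])).
  move=> y [_ /andP[_ dh2]]; exists (dist x y) => //=.
  by rewrite /dist; case: ex_minnP.
by apply: bigcup_finite => [|n _]; [exact: finite_II|exact: sphere_finite].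
Qed.

(** * Averages and the share of a piece *)

Lemma waverage_lt (R : realType) (T : tree) (w mu f : T -> R) (E : set T)
    (c : R) :
  positive_fun w -> positive_fun mu -> finite_set E -> E !=set0 ->
  (waverage w mu f E < c%:E) =
  (mass (fun y => `|f y| * w y * mu y)%R E < c%:E * wmass w mu E).
Proof.
move=> w0 mu0 fE En0; have wmu0 : positive_fun (fun y => w y * mu y)%R.
  by move=> y; rewrite mulr_gt0.
have := mass_gt0 wmu0 En0; rewrite /waverage -/(mass _ E) /wmass.
rewrite -(fineK (mass_fin_num _ fE)) => [|y]; last exact: ltW.
by rewrite lte_fin => W0; rewrite inver gt_eqF// lte_pdivrMl// muleC.
Qed.

(** The weight condition is applied to the complement of P in E, which is small
for mu because P is large; finiteness of E allows the complementary masses to be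
subtracted. *)
Lemma wmass_heavy_child (R : realType) (T : tree) (w mu : T -> R) (CD eta : R)
    (E P : set T) :
  positive_fun w -> positive_fun mu -> finite_set E -> P `<=` E ->
  (forall S : set T, S `<=` E -> mass mu S <= (1 - CD)%:E * mass mu E ->
     wmass w mu S <= eta%:E * wmass w mu E) ->
  CD%:E * mass mu E <= mass mu P ->
  (1 - eta)%:E * wmass w mu E <= wmass w mu P.
Proof.
move=> w0 mu0 fE PE muw CDP.
have fin (nu : T -> R) : positive_fun nu ->
    exists m p q : R, [/\ mass nu E = m%:E, mass nu P = p%:E,
      mass nu (E `\` P) = q%:E & m = p + q]%R.
  move=> nu_gt0; have nu0 x : (0 <= nu x)%R by exact: ltW.
  have fP := sub_finite_set PE fE; have fD := finite_setD P fE.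
  exists (fine (mass nu E)), (fine (mass nu P)), (fine (mass nu (E `\` P))).
  rewrite !fineK ?mass_fin_num//; split=> //.
  by rewrite (mass_split nu0 PE) fineD// mass_fin_num.
have [m [p [q [mE mP mD mpq]]]] := fin _ mu0.
have wmu0 : positive_fun (fun y => w y * mu y)%R by move=> y; rewrite mulr_gt0.
have [m' [p' [q' [wE wP wD wpq]]]] := fin _ wmu0.
have := muw (E `\` P) (@subDsetl _ _ _).
move: CDP; rewrite /wmass mE mP mD wE wP wD -!EFinM !lee_fin => CDP.
have H : (q <= (1 - CD) * m)%R by nra.
by move=> /(_ H) ?; nra.
Qed.

(** * The stopping-time selection *)

(** Selected sets are moreover required to lie inside E: this keeps families
built inside disjoint pieces disjoint from one another. *)
Definition stopping_family (R : realType) (T : tree) (omega : boundary T)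
    (beta : R) (w mu f : T -> R) (DCZ lambda : R) (E : set T)
    (F : set (set T)) : Prop :=
  [/\ F `<=` trapezoid_family omega beta,
      trivIset F id,
      (forall A, F A -> A `<=` E),
      (forall A, F A -> lambda%:E <= waverage w mu f A /\
                        waverage w mu f A < (DCZ * lambda)%:E) &
      (forall x, (E `\` \bigcup_(A in F) A) x -> (`|f x| < lambda)%R)].

Lemma stopping_family0 (R : realType) (T : tree) (omega : boundary T)
    (beta : R) (w mu f : T -> R) (DCZ lambda : R) (E : set T) :
  (forall x, E x -> (`|f x| < lambda)%R) ->
  stopping_family omega beta w mu f DCZ lambda E set0.
Proof. by move=> flt; split=> // x [/flt]. Qed.

Lemma stopping_family1 (R : realType) (T : tree) (omega : boundary T)
    (beta : R) (w mu f : T -> R) (DCZ lambda : R) (E : set T) :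
  trapezoid_family omega beta E ->
  lambda%:E <= waverage w mu f E -> waverage w mu f E < (DCZ * lambda)%:E ->
  stopping_family omega beta w mu f DCZ lambda E [set E].
Proof.
move=> ET lamE Elam; split=> [_ ->//||_ ->//|_ ->//|x []].
  by move=> A B -> ->.
by rewrite bigcup_set1.
Qed.

(** Families selected independently in disjoint pieces can be put together; two
selected sets that meet must come from the same piece. *)
Lemma stopping_family_bigcup (R : realType) (T : tree) (omega : boundary T)
    (beta : R) (w mu f : T -> R) (DCZ lambda : R) (I : eqType) (J : set I)
    (P : I -> set T) (G : I -> set (set T)) :
  trivIset J P ->
  (forall i, J i -> stopping_family omega beta w mu f DCZ lambda (P i) (G i)) ->
  stopping_family omega beta w mu f DCZ lambda
    (\bigcup_(i in J) P i) (\bigcup_(i in J) G i).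
Proof.
move=> trivP GP; split.
- by move=> A [i Ji GA]; have [+ _ _ _ _] := GP i Ji; apply.
- move=> A B [i Ji GA] [j Jj GB] [x [/= Ax Bx]].
  have [_ _ subi _ _] := GP i Ji; have [_ _ subj _ _] := GP j Jj.
  have eij : i = j.
    by apply: trivP => //; exists x; split; [exact: subi Ax|exact: subj Bx].
  have [_ + _ _ _] := GP i Ji; apply => //; first by rewrite eij.
  by exists x.
- move=> A [i Ji GA] x Ax; exists i => //.
  by have [_ _ + _ _] := GP i Ji; apply; first exact: GA.
- by move=> A [i Ji GA]; have [_ _ _ + _] := GP i Ji; apply.
- move=> x [[i Ji Px] nGx]; have [_ _ _ _ +] := GP i Ji; apply; split=> //.
  by move=> [A GA Ax]; apply: nGx; exists A => //; exists i.
Qed.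

(** By induction on the cardinality of E. Either E has at most one point, and
nothing has to be selected; or it is decomposed, and each piece is selected or
handled by the induction hypothesis, according to its average. *)
Lemma stopping_family_exists (R : realType) (T : tree) (omega : boundary T)
    (mu w : T -> R) (beta CD eta : R) (N : nat) (f : T -> R) (lambda : R) :
  positive_fun mu -> positive_fun w ->
  (forall x : T, finite_set [set y | adj x y]) ->
  (0 < CD)%R -> (0 < eta < 1)%R -> (0 < lambda)%R ->
  decomposition_property omega beta mu CD N ->
  (forall E S : set T, trapezoid_family omega beta E -> S `<=` E ->
     mass mu S <= (1 - CD)%:E * mass mu E ->
     wmass w mu S <= eta%:E * wmass w mu E) ->
  forall E : set T, trapezoid_family omega beta E ->
    waverage w mu f E < lambda%:E ->
    exists F, stopping_family omega beta w mu f (1 - eta)^-1%R lambda E F.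
Proof.
move=> mu0 w0 nbfin CD0 /andP[eta0 eta1] lam0 decomp muw.
have wmu0 : positive_fun (fun y => w y * mu y)%R by move=> y; rewrite mulr_gt0.
have g0 y : (0 <= `|f y| * w y * mu y)%R.
  by rewrite -mulrA mulr_ge0// ltW//; exact: wmu0.
move=> E; have [n] := ubnP #|` fset_set E|.
elim: n E => // n IHn E; rewrite ltnS => cardE ET avgE.
have fE := trapezoid_family_finite nbfin ET.
have [[a [b [Ea Eb ab]]]|E1] :=
    pselect (exists x y, [/\ E x, E y & x != y]); last first.
  exists set0; apply: stopping_family0 => x Ex.
  have Ex1 : E = [set x].
    apply/seteqP; split=> [y Ey|_ -> //]; apply: contrapT => yx.
    by apply: E1; exists y, x; split=> //; apply/eqP.
  have En0 : E !=set0 by exists x.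
  move: avgE; rewrite waverage_lt// Ex1 /wmass !mass_set1//; last first.
    by move=> y; exact: ltW.
  by rewrite -EFinM lte_fin -mulrA ltr_pM2r//; exact: wmu0.
have En0 : E !=set0 by exists a.
have [|M [P [/andP[M2 _] trivP EP PT CDP]]] := decomp E ET; first by exists a, b.
have PE i : (i < M)%N -> P i `<=` E by move=> iM x Px; rewrite EP; exists i.
have Pn0 i : (i < M)%N -> P i !=set0.
  move=> iM; apply/set0P/eqP => Pi0; have := CDP i iM.
  rewrite leNgt Pi0 {1}/mass esum_set0 mule_gt0 ?lte_fin//; exact: mass_gt0.
have piece i : exists F, (i < M)%N ->
    stopping_family omega beta w mu f (1 - eta)^-1%R lambda (P i) F.
  have [iM|] := ltnP i M; last by exists set0.
  have fP : finite_set (P i) := sub_finite_set (PE i iM) fE.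
  have [avgP|avgP] := ltP (waverage w mu f (P i)) lambda%:E.
    have [||//|F PF] := IHn (P i); [|exact: PT|by exists F].
    apply: leq_trans cardE.
    (* Another piece P j is nonempty and disjoint from P i, so P i is proper. *)
    have [j jM ij] : exists2 j, (j < M)%N & i != j.
      by exists (i == 0%N : nat); [case: (i == _); lia|case: (i)].
    have [x Px] := Pn0 j jM.
    apply/fproper_ltn_card; rewrite fproperE; apply/andP; split.
      apply/fsubsetP => y; rewrite !in_fset_set//.
      by rewrite !inE; exact: PE.
    apply/negP => /fsubsetP EPi; apply/negP: ij; rewrite negbK; apply/eqP.
    apply: trivP => //; exists x; split=> //.
    have := EPi x; rewrite !in_fset_set//.
    by rewrite !inE; apply; exact: PE Px.
  exists [set P i] => _; apply: stopping_family1 => //; first exact: PT.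
  rewrite waverage_lt//; last exact: Pn0.
  apply: le_lt_trans (le_mass g0 (PE i iM)) _.
  (* int_P |f| w <= int_E |f| w < lambda w(E) <= lambda w(P) / (1 - eta) *)
  have := avgE; rewrite waverage_lt// => /lt_le_trans; apply.
  have := wmass_heavy_child w0 mu0 fE (PE i iM) (fun S => muw E S ET) (CDP i iM).
  rewrite /wmass.
  rewrite -(fineK (mass_fin_num (fun y => ltW (wmu0 y)) fE)).
  rewrite -(fineK (mass_fin_num (fun y => ltW (wmu0 y)) fP)).
  rewrite -!EFinM !lee_fin => heavy.
  rewrite [((1 - eta)^-1 * _)%R]mulrC -mulrA ler_pM2l// ler_pdivlMl// subr_gt0.
  exact: eta1.
have [G GP] := choice piece.
exists (\bigcup_(i in `I_M) G i); rewrite EP.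
exact: stopping_family_bigcup.
Qed.

Unset Implicit Arguments.

Theorem proposition3p6 (R : realType) (T : tree) (omega : boundary T) (o : T)
  (mu : T -> R)
  (mu_flow : flow_measure omega o mu)
  (mu_doubling : locally_doubling mu)
  (beta : R) (beta_ge12 : (12 <= beta)%R)
  (CD : R) (N : nat) (CD01 : (0 < CD < 1)%R)
  (CD_spec : decomposition_property omega beta mu CD N)
  (w : T -> R) (w_weight : positive_fun w)
  (w_cond : exists eta : R, (0 < eta < 1)%R /\
     forall E S : set T, trapezoid_family omega beta E -> S `<=` E ->
       mass mu S <= (1 - CD)%:E * mass mu E ->
       wmass w mu S <= eta%:E * wmass w mu E) :
  exists DCZ : R,
    forall (f : T -> R) (lambda : R) (E0 : set T),
      (0 < lambda)%R ->
      trapezoid_family omega beta E0 ->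
      waverage w mu f E0 < lambda%:E ->
      exists F : set (set T),
        [/\ F `<=` trapezoid_family omega beta,
            trivIset F id,
            (forall E, F E ->
               lambda%:E <= waverage w mu f E /\
               waverage w mu f E < (DCZ * lambda)%:E) &
            (forall x, (E0 `\` \bigcup_(E in F) E) x -> (`|f x| < lambda)%R)].
Proof.
have [mu0 _] := mu_flow; have [eta [eta01 muw]] := w_cond.
have /andP[CD0 _] := CD01.
exists (1 - eta)^-1%R => f lambda E0 lam0 E0T avgE0.
have nbfin := neighbours_finite mu0 mu_doubling.
have [F [FT trivF _ avgF fF]] :=
  stopping_family_exists mu0 w_weight nbfin CD0 eta01 lam0 CD_spec muw
    E0T avgE0.
by exists F; split.
Qed.
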